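(* Suppose that $\langle e_\beta:\beta<\omega_1\rangle$ is a coherent sequence of finite-to-one functions with $e_\beta:\beta\to\omega$ for each $\beta<\omega_1$, and suppose that $L:[\omega_1]^2\to[\omega_1]^{<\aleph_0}$ satisfies the properties of a lower trace function. If $A,B\subseteq\omega_1$ are uncountable, then the set of integers of the form $$\operatorname{osc}(e_\alpha\restriction L(\alpha,\beta),\ e_\beta\restriction L(\alpha,\beta))$$ for $\alpha<\beta$ with $\alpha\in A$ and $\beta\in B$ contains arbitrarily long intervals (i.e. for every $n<\omega$ it contains $n$ consecutive integers).
   Context: $[\omega_1]^{<\aleph_0}$ is the set of finite subsets of $\omega_1$. A family of functions is coherent if any two of its members differ on only finitely many points of the intersection of their domains. For sets of ordinals $a,b$, $a<b$ means every element of $a$ is less than every element of $b$ (vacuously true if one is empty). $L$ satisfies the properties of a lower trace function if, writing $L(\alpha,\alpha)=\emptyset$ and $L(\alpha,\beta)=L(\{\alpha,\beta\})$ for $\alpha<\beta$, we have $L(\alpha,\beta)\subseteq\alpha$ and: (1) if $\alpha\leq\beta\leq\gamma$ and $L(\beta,\gamma)<L(\alpha,\beta)$, then $L(\alpha,\gamma)=L(\alpha,\beta)\cup L(\beta,\gamma)$; (2) if $\delta<\omega_1$ is a limit ordinal, then $\lim_{\xi\to\delta}\min L(\xi,\delta)=\delta$, i.e. for every $\gamma_0<\delta$ there is $\gamma<\delta$ such that for all $\xi$ with $\gamma<\xi<\delta$, $L(\xi,\delta)$ is non-empty and $\min L(\xi,\delta)>\gamma_0$. For functions $s,t$ into $\omega$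 defined on a common finite set of ordinals $F$, $\operatorname{osc}(s,t)$ is the number of $\xi\in F$ with $\xi\neq\min F$ such that $s(\xi^-)\leq t(\xi^-)$ and $s(\xi)>t(\xi)$, where $\xi^-$ is the greatest element of $F$ less than $\xi$. *)

(* Defs.v *)
From HB Require Import structures.
From mathcomp Require Import all_boot all_order.
From mathcomp Require Import finmap.
From mathcomp Require Import mathcomp_extra boolp classical_sets functions.
From mathcomp Require Import cardinality wochoice.

Set Implicit Arguments.
Unset Strict Implicit.
Unset Printing Implicit Defensive.

Import Order.TTheory.

Local Open Scope classical_set_scope.
Local Open Scope order_scope.

(* The order type of W is omega_1: W is an uncountable well-order all of whose
   proper initial segments are countable.  As in set theory, an element b
   stands for the set of elements below it. *)
Record is_omega1 (d : Order.disp_t) (W : orderType d) : Prop := IsOmega1 {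
  omega1_wf : well_founded (fun x y : W => x < y) ;
  omega1_initial_countable : forall b : W, countable [set x : W | x < b] ;
  omega1_uncountable : ~ countable [set: W] }.

Section Omega1.
Context {d : Order.disp_t} {W : orderType d}.
Implicit Types (a b c x y : W) (F G : {fset W}) (s t : W -> nat).

(* A sequence of functions e_b : b -> omega is given by e : W -> W -> nat; only
   the values e b x with x < b are ever referred to. *)
Definition finite_to_one (e : W -> W -> nat) : Prop :=
  forall b (n : nat), finite_set [set x | x < b /\ e b x = n].

Definition coherent (e : W -> W -> nat) : Prop :=
  forall b c, finite_set [set x | [/\ x < b, x < c & e b x <> e c x]].

Definition fset_lt F G : Prop :=
  forall x y, x \in F -> y \in G -> x < y.

Definition is_fmin F x : bool :=
  (x \in F) && [forall y : F, x <= val y].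

Definition is_limit b : Prop :=
  (exists x, x < b) /\ (forall x, x < b -> exists y, x < y /\ y < b).

(* A function on [omega_1]^2 is given by L : {fset W} -> {fset W}; only its
   values at two-element sets are ever referred to. *)
Definition ltr (L : {fset W} -> {fset W}) a b : {fset W} :=
  if a == b then fset0 else L [fset a; b]%fset.

Record lower_trace (L : {fset W} -> {fset W}) : Prop := LowerTrace {
  lower_trace_sub : forall a b, a < b -> forall x, x \in ltr L a b -> x < a ;
  lower_trace_cat : forall a b c, a <= b -> b <= c ->
    fset_lt (ltr L b c) (ltr L a b) ->
    ltr L a c = (ltr L a b `|` ltr L b c)%fset ;
  lower_trace_lim : forall b, is_limit b ->
    forall c0, c0 < b -> exists2 c, c < b &
      forall x, c < x -> x < b ->
        exists2 m, is_fmin (ltr L x b) m & c0 < m }.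

(* y is the greatest element of F less than x. *)
Definition is_fpred F x y : bool :=
  [&& y \in F, y < x & [forall z : F, (val z < x) ==> (val z <= y)]].

(* osc F s t is the oscillation of the restrictions of s and t to F. *)
Definition osc F s t : nat :=
  #|` [fset x in F | ~~ is_fmin F x &&
        [exists y : F, [&& is_fpred F x (val y),
                           (s (val y) <= t (val y))%N & (t x < s x)%N]]]%fset|.

End Omega1.

Lemma uncountable_setnat : ~ countable [set: set nat].
Proof.
move=> /countable_injP[f finj0].
have finj : injective f by move=> x y; apply: finj0; rewrite inE.
pose D := [set n | exists X : set nat, f X = n /\ ~ X n].
have H : D (f D) <-> ~ D (f D).
  split; first by move=> [X [/finj -> ]].
  by move=> nD; exists D.
tauto.
Qed.

(* Quantifying over all W with is_omega1 W is not vacuous. *)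
Lemma omega1_exists : exists (d : Order.disp_t) (W : orderType d), is_omega1 W.
Proof.
have [R woR] := well_ordering_principle (set nat).
have mn (P : set (set nat)) x : P x -> exists2 z, P z & forall y, P y -> R z y.
  move=> Px; have [|z [[/= Pz zmin] _]] := woR [pred y | `[< P y >]].
    by exists x; apply/asboolP.
  exists z; first exact/asboolP.
  by move=> y Py; apply: zmin; apply/asboolP.
have Rxx : reflexive R by move=> x; have [z ->] := mn [set x] x erefl; apply.
have Ranti : antisymmetric R.
  move=> x y /andP[xy yx].
  have [|z [_ zu]] := woR [pred u | (u == x) || (u == y)].
    by exists x; rewrite inE eqxx.
  have zx : z = x.
    apply: zu; split; first by rewrite inE eqxx.
    by move=> u; rewrite inE => /orP[] /eqP-> /=; rewrite ?Rxx ?xy ?yx.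
  have zy : z = y.
    apply: zu; split; first by rewrite inE eqxx orbT.
    by move=> u; rewrite inE => /orP[] /eqP-> /=; rewrite ?Rxx ?xy ?yx.
  by rewrite -zx zy.
have Rtot : total R.
  move=> x y; have [z zxy zm] := mn [set x; y] x (or_introl erefl).
  case: zxy => <-; [rewrite zm ?orbT//|apply/orP; right; apply: zm]; by [left|right].
have Rtr : transitive R.
  move=> y x z xy yz; have [w ww wm] := mn [set x; y; z] x (or_introl (or_introl erefl)).
  have wx : R w x by apply: wm; left; left.
  have wy : R w y by apply: wm; left; right.
  have wz : R w z by apply: wm; right.
  case: ww => [[] |] e; move: e => /= e; subst w => //.
  - by rewrite (Ranti x y) // xy wx.
  - by rewrite -(Ranti y z) ?yz.
pose seg x := [set y | y != x /\ R y x].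
pose P x := `[< countable (seg x) >].
pose W0 := {x : set nat | P x}.
pose le (x y : W0) := R (val x) (val y).
have lexx : reflexive le by move=> x; exact: Rxx.
have lea : antisymmetric le by move=> x y h; apply: val_inj; exact: Ranti.
have let_ : transitive le by move=> y x z; exact: Rtr.
have leto : total le by move=> x y; exact: Rtot.
pose m1 := Order.Le_isPOrder.Build (Order.Disp tt tt) W0 lexx lea let_.
pose p := HB.pack_for (porderType (Order.Disp tt tt)) W0 m1.
pose m2 := Order.POrder_isTotal.Build (Order.Disp tt tt) p leto.
pose W := HB.pack_for (orderType (Order.Disp tt tt)) W0 m1 m2.
exists (Order.Disp tt tt), W.
have ltE (x y : W) : (x < y)%O = (val x != val y) && R (val x) (val y).
  by rewrite lt_neqAle.
split.
- move=> x; apply: contrapT => nx.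
  have [] := mn [set y | exists w : W, val w = y /\ ~ Acc (fun a b : W => (a < b)%O) w] (val x).
    by exists x.
  move=> _ [w [<- nw]] wm; apply: nw; constructor => y; rewrite ltE => /andP[ne yw].
  apply: contrapT => ny; move: ne; rewrite (Ranti (val y) (val w)) ?eqxx //.
  by rewrite yw wm //; exists y.
- move=> b; have /asboolP cb := valP b.
  have /countable_injP[f fi] := cb.
  apply/countable_injP; exists (fun x : W => f (val x)) => x y.
  rewrite !in_setE /= !ltE => /andP[x1 x2] /andP[y1 y2] exy; apply: val_inj.
  by apply: fi => //; rewrite in_setE.
- move=> cW.
  have cP : countable [set x | P x].
    apply: (@sub_countable _ _ _ [set val x | x in [set: W]]).
      apply: subset_card_le => x Px; by exists (exist _ x Px).
    exact: card_le_trans (card_image_le _ _) cW.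
  have [x nPx] : exists x, ~ P x.
    apply: contrapT => h; apply: uncountable_setnat; apply: sub_countable cP.
    by apply: subset_card_le => x _; apply: contrapT => nPx; apply: h; exists x.
  have [z nPz zm] := mn [set x | ~ P x] x nPx.
  apply: nPz; apply/asboolP; apply: sub_countable cP; apply: subset_card_le => y [yz yR].
  apply: contrapT => nPy; move: yz; rewrite (Ranti y z) ?eqxx// yR zm//.
Qed.

(* Main.v *)
Require Import Defs.
From mathcomp Require Import all_boot all_order finmap.
From mathcomp Require Import boolp classical_sets cardinality.
Set Implicit Arguments.
Unset Strict Implicit.
Unset Printing Implicit Defensive.
Import Order.TTheory.
Local Open Scope order_scope.
Local Open Scope classical_set_scope.

(** The idea, due to J. T. Moore, is to compute oscillations above a level v of
    omega_1 that reflects, that is, behaves like the trace on omega_1 of a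
    countable elementary submodel.

    At such a level ([critical]) a pair a in A, b in B above v can be replaced
    by a pair a', b' for which L(v, b') is L(v, b) followed by a nonempty block
    G below v, while the values on L(v, b) do not change.  On G one can have
    either e_a' = e_b' ([extension_eq]) or e_a' > e_b' ([extension_gt]).  A block
    of equality creates no oscillation; a block of strict inequality put after
    it creates exactly one, at its first point.  Hence the two extensions in
    succession raise the oscillation over L(v, b) by exactly one ([osc_succ]).
    Iterating gives b_0, ..., b_n above v and one a such that the oscillations
    of e_a and e_(b_i) over L(v, b_i) are k, k + 1, ..., k + n
    ([osc_interval]).

    It remains to bring a below v, so that the L(a, b_i) are computed from a
    common piece.  Reflection provides a' < v in A with the same values on the
    L(v, b_i), and so large that L(a', v) lies above all L(v, b_i) and above
    every point below v at which two of the e_(b_i) differ.  Then L(a', b_i) is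
    L(v, b_i) followed by L(a', v); the second piece contributes the same number
    for every i, and nothing happens at the joint because e_a' > e_(b_i) at the
    last point of L(v, b_i).  So the oscillations over the L(a', b_i) are again
    consecutive.

    Reflection only involves finitely many points below v and finitely many
    values in omega at a time, so it is enough that v be closed under countably
    many operations from finite sequences to omega_1 ([exists_reflecting]). *)

(** * Reflection in omega_1 *)

Lemma countable_setU (T : Type) (S S' : set T) :
  countable S -> countable S' -> countable (S `|` S').
Proof.
move=> cS cS'.
have -> : S `|` S' = \bigcup_(i in [set: bool]) (if i then S else S').
  apply/seteqP; split=> x; last by case=> -[] _; [left|right].
  by case=> ?; [exists true|exists false].
by apply: bigcup_countable => [|[]].
Qed.

Section Omega1Order.
Context {d : Order.disp_t} {W : orderType d} (HW : is_omega1 W).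
Implicit Types (a b c x y : W) (S : set W).

Lemma omega1_least S x : S x -> exists2 z, S z & forall y, S y -> z <= y.
Proof.
elim/(well_founded_ind (omega1_wf HW)): x => x IH Sx.
have [[y [Sy yx]]|nS] := pselect (exists y, S y /\ y < x); first exact: IH yx Sy.
exists x => // y Sy; rewrite leNgt; apply/negP => yx; apply: nS; by exists y.
Qed.

Lemma countable_le b : countable [set x : W | x <= b].
Proof.
have -> : [set x : W | x <= b] = [set x | x < b] `|` [set b].
  apply/seteqP; split=> x /=; first by rewrite le_eqVlt => /orP[/eqP->|]; [right|left].
  by case=> [/ltW|->].
exact: countable_setU (omega1_initial_countable HW b) (countable1 b).
Qed.

Lemma countable_bounded S : countable S -> exists y, forall x, S x -> x < y.
Proof.
move=> cS; apply: contrapT => nb; apply: (omega1_uncountable HW).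
apply: (@sub_countable _ _ _ (\bigcup_(x in S) [set z | z <= x])).
  apply: subset_card_le => z _; apply: contrapT => nz; apply: nb; exists z => x Sx.
  by rewrite ltNge; apply/negP => zx; apply: nz; exists x.
by apply: bigcup_countable => // x _; exact: countable_le.
Qed.

Lemma uncountable_unbounded S : ~ countable S -> forall b, exists2 a, S a & b <= a.
Proof.
move=> uS b; apply: contrapT => nb; apply: uS.
apply: sub_countable (omega1_initial_countable HW b); apply: subset_card_le => x Sx.
by rewrite /= ltNge; apply/negP => bx; apply: nb; exists x.
Qed.

Lemma limit_bounds_seq (b : W) (s : seq W) :
  is_limit b -> all (< b) s -> exists2 c, c < b & all (< c) s.
Proof.
move=> [[x xb] lim]; elim: s => [|y s IH] /=; first by exists x.
move=> /andP[yb /IH[c cb sc]]; have [y' [yy' y'b]] := lim y yb.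
exists (Order.max y' c); first by rewrite gt_max y'b.
rewrite /= lt_max yy' /=; apply: sub_all sc => z /= zc.
by rewrite lt_max zc orbT.
Qed.

Lemma limit_bounds_finite (b : W) S :
  is_limit b -> finite_set S -> (forall x, S x -> x < b) ->
  exists2 c, c < b & forall x, S x -> x < c.
Proof.
move=> lim /finite_fsetP[X SX] Sb.
have [|c cb Xc] := @limit_bounds_seq b X lim.
  by apply/allP => x xX; apply: Sb; rewrite SX.
by exists c => // x; rewrite SX => /= xX; exact: (allP Xc).
Qed.

(** The existential half of elementarity, for one family of sets with parameters:
    countably many k, and ordinals below b.  The universal half is obtained by
    applying it to sets of upper bounds or of counterexamples. *)
Definition reflects (K : Type) (Q : K -> seq W -> set W) (b : W) : Prop :=
  forall k s, all (< b) s -> Q k s !=set0 -> exists2 y, y < b & Q k s y.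

Lemma countable_params (K : countType) b :
  countable [set ks : K * seq W | all (<= b) ks.2].
Proof.
have /countable_injP[f finj] := countable_le b.
apply/countable_injP; exists (fun ks => choice.pickle (ks.1, map f ks.2)).
move=> [k s] [k' s']; rewrite !in_setE /= => sb sb' /(pcan_inj choice.pickleK)[-> ss'].
congr pair; elim: s s' sb sb' ss' => [|x s IH] [|x' s'] //= /andP[xb sb] /andP[xb' sb'] [fx /IH->//].
by congr (_ :: _); apply: finj; rewrite ?in_setE.
Qed.

(** Closing off: only countably many parameters lie below a given level, so the
    chosen witnesses for them lie below some higher level.  Iterate this omega
    times and take the supremum. *)
Lemma exists_reflecting (K : countType) (Q : K -> seq W -> set W) c :
  exists b, [/\ c < b, is_limit b & reflects Q b].
Proof.
(* h is a Skolem function; its default value c serves the empty Q k s. *)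
pose h ks := if pselect (Q ks.1 ks.2 !=set0) is left q then projT1 (cid q) else c.
have hP k s : Q k s !=set0 -> Q k s (h (k, s)).
  by rewrite /h; case: pselect => //= q _; case: cid.
have gP b : exists b', b < b' /\ forall k s, all (<= b) s -> h (k, s) < b'.
  have [b' bb'] : exists b', forall x,
      ([set b] `|` h @` [set ks | all (<= b) ks.2]) x -> x < b'.
    apply/countable_bounded/countable_setU; first exact: countable1.
    exact: card_le_trans (card_image_le _ _) (countable_params K b).
  exists b'; split; first by apply: bb'; left.
  by move=> k s sb; apply: bb'; right; exists (k, s).
have [g gg] := choice gP.
pose u n := iter n g c.
have uS n : u n < u n.+1 by have [] := gg (u n).
have [z0 z0u] : exists z, forall x, range u x -> x < z.
  by apply: countable_bounded; exact: card_le_trans (card_image_le _ _) (countableP _).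
have [|b bu bmin] := @omega1_least [set z | forall n, u n < z] z0.
  by move=> n; apply: z0u; exists n.
have bu' x : x < b -> exists n, x <= u n.
  move=> xb; apply: contrapT => nx; move: xb; rewrite ltNge bmin // => n /=.
  by rewrite ltNge; apply/negP => xu; apply: nx; exists n.
have umono m n : (m <= n)%N -> u m <= u n.
  elim: n => [|n IH]; first by rewrite leqn0 => /eqP->.
  rewrite leq_eqVlt => /orP[/eqP->//|/IH mn]; exact: le_trans mn (ltW (uS n)).
exists b; split; first exact: (bu 0%N).
  split=> [|x /bu'[n xn]]; first by exists c; exact: (bu 0%N).
  by exists (u n.+1); split; [exact: le_lt_trans (uS n)|].
move=> k s sb Qks.
have [n sn] : exists n, all (<= u n) s.
  elim: s sb {Qks} => [|x s IH] /=; first by exists 0%N.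
  move=> /andP[/bu'[m xm] /IH[n sn]]; exists (maxn m n).
  rewrite (le_trans xm) ?umono ?leq_maxl //=; apply: sub_all sn => y /= yn.
  by rewrite (le_trans yn) ?umono ?leq_maxr.
exists (h (k, s)); last exact: hP.
by apply: lt_trans (bu n.+1); have [_] := gg (u n); exact.
Qed.

End Omega1Order.

(** * Oscillation along a concatenation of finite sets *)

Section Oscillation.
Context {d : Order.disp_t} {W : orderType d}.
Implicit Types (x y z : W) (F G : {fset W}) (s t : W -> nat).

Definition consecutive F y x : Prop :=
  [/\ y \in F, x \in F, y < x & forall z, z \in F -> z < x -> z <= y].

Definition is_fmax F y : Prop := y \in F /\ forall z, z \in F -> z <= y.

Lemma fminP F x : reflect (x \in F /\ forall z, z \in F -> x <= z) (is_fmin F x).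
Proof.
apply: (iffP andP) => -[xF xmin]; split=> //.
  by move=> z zF; exact: (forallP xmin [` zF]%fset).
by apply/forallP => z; exact: xmin (valP z).
Qed.

Definition osc_set F s t : {fset W} :=
  [fset x in F | `[< exists y, [/\ consecutive F y x, (s y <= t y)%N & (t x < s x)%N] >]]%fset.

Lemma osc_setP F s t x :
  reflect (exists y, [/\ consecutive F y x, (s y <= t y)%N & (t x < s x)%N])
          (x \in osc_set F s t).
Proof.
apply: (iffP idP); first by rewrite !inE => /andP[_ /asboolP].
move=> xy; rewrite !inE; apply/andP; split; last exact/asboolP.
by have [y [[]]] := xy.
Qed.

Lemma oscE F s t : osc F s t = #|` osc_set F s t|.
Proof.
congr #|` _|; apply/fsetP => x; apply/idP/osc_setP.
  rewrite !inE => /andP[xF /andP[_ /existsP[y /and3P[/and3P[yF yx ymax] sy tx]]]].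
  exists (val y); split=> //; split=> // z zF zx.
  exact: (implyP (forallP ymax [` zF]%fset)).
move=> [y [[yF xF yx ymax] sy tx]]; rewrite !inE xF /=; apply/andP; split.
  by apply/fminP => -[_ /(_ y yF)]; rewrite leNgt yx.
apply/existsP; exists [` yF]%fset; apply/and3P; split=> //; apply/and3P; split=> //.
by apply/forallP => z; apply/implyP; exact: ymax (valP z).
Qed.

Lemma eq_osc F s t s' t' : {in F, s =1 s'} -> {in F, t =1 t'} ->
  osc F s t = osc F s' t'.
Proof.
move=> ss tt; rewrite !oscE; congr #|` _|; apply/fsetP => x.
apply/osc_setP/osc_setP => -[y [c sy tx]]; have [yF xF _ _] := c; exists y.
  by rewrite -!ss -?tt.
by rewrite !ss ?tt.
Qed.

(** When F lies below G, the only new consecutive pair in the union is the joint,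
    formed by the last point of F and the first point of G. *)
Lemma consecutiveU F G y x : fset_lt F G -> consecutive (F `|` G)%fset y x <->
  [\/ consecutive F y x, consecutive G y x | is_fmax F y /\ is_fmin G x].
Proof.
move=> FG; split.
  move=> [+ + yx ymax]; rewrite !inE => yFG xFG.
  have ymax' z : z \in F \/ z \in G -> z < x -> z <= y.
    by move=> zFG; apply: ymax; rewrite inE; apply/orP.
  case/orP: xFG => xF; case/orP: yFG => yF.
  - by apply: Or31; split=> // z zF; apply: ymax'; left.
  - by have := lt_trans yx (FG _ _ xF yF); rewrite ltxx.
  - apply: Or33; split.
      by split=> // z zF; apply: ymax'; [left|exact: FG].
    apply/fminP; split=> // z zG; rewrite leNgt; apply/negP => zx.
    by have := FG _ _ yF zG; rewrite ltNge ymax' //; right.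
  - by apply: Or32; split=> // z zF; apply: ymax'; right.
case=> [[yF xF yx ymax]|[yG xG yx ymax]|[[yF ymax] /fminP[xG xmin]]].
- split; rewrite ?inE ?yF ?xF // => z; rewrite inE => /orP[|zG]; first exact: ymax.
  by move=> zx; have := lt_trans zx (FG _ _ xF zG); rewrite ltxx.
- split; rewrite ?inE ?yG ?xG ?orbT // => z; rewrite inE => /orP[zF _|]; last exact: ymax.
  exact/ltW/FG.
- split; rewrite ?inE ?yF ?xG ?orbT //; first exact: FG.
  move=> z; rewrite inE => /orP[zF _|zG]; first exact: ymax.
  by rewrite ltNge xmin.
Qed.

Lemma osc_setU F G s t : fset_lt F G ->
  #|` (osc_set F s t `|` osc_set G s t)%fset| = (osc F s t + osc G s t)%N.
Proof.
move=> FG; rewrite !oscE -cardfsUI -[LHS]addn0; congr addn.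
apply/esym/eqP; rewrite cardfs_eq0; apply/eqP/fsetP => x; rewrite in_fset0.
apply/negP; rewrite inE => /andP[/osc_setP[? [[_ xF _ _] _ _]] /osc_setP[? [[_ xG _ _] _ _]]].
by have := FG _ _ xF xG; rewrite ltxx.
Qed.

(** The hypothesis says that the joint is not an oscillation point. *)
Lemma osc_cat F G s t : fset_lt F G ->
  (forall y x, is_fmax F y -> is_fmin G x -> (s y <= t y)%N -> (s x <= t x)%N) ->
  osc (F `|` G)%fset s t = (osc F s t + osc G s t)%N.
Proof.
move=> FG joint; rewrite -osc_setU // oscE; congr #|` _|; apply/fsetP => x.
apply/osc_setP/idP.
  move=> [y [/consecutiveU[]//]]; rewrite inE.
  - by move=> c sy tx; apply/orP; left; apply/osc_setP; exists y.
  - by move=> c sy tx; apply/orP; right; apply/osc_setP; exists y.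
  - by move=> [yF xG] /(joint _ _ yF xG) sx; rewrite ltnNge sx.
by rewrite inE => /orP[]/osc_setP[y [c sy tx]]; exists y; split=> //;
  apply/consecutiveU => //; [apply: Or31|apply: Or32].
Qed.

Lemma osc_cat_joint F G s t y x : fset_lt F G -> is_fmax F y -> is_fmin G x ->
  (s y <= t y)%N -> (t x < s x)%N ->
  osc (F `|` G)%fset s t = (osc F s t + osc G s t).+1.
Proof.
move=> FG yF xG sy tx; rewrite -osc_setU // oscE -add1n.
have [yF' ymax] := yF; have [xG' xmin] := fminP _ _ xG.
have -> : osc_set (F `|` G)%fset s t = (x |` (osc_set F s t `|` osc_set G s t))%fset.
  apply/fsetP => z; rewrite !in_fsetU in_fset1; apply/osc_setP/idP.
    move=> [w [/consecutiveU[]//]].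
    - by move=> c sw tz; apply/or3P/Or32/osc_setP; exists w.
    - by move=> c sw tz; apply/or3P/Or33/osc_setP; exists w.
    - move=> [_ /fminP[zG zmin]] _ _; apply/orP; left; apply/eqP/le_anti.
      by rewrite zmin // xmin.
  case/or3P => [/eqP->|/osc_setP[w [c sw tz]]|/osc_setP[w [c sw tz]]].
  - by exists y; split=> //; apply/consecutiveU/Or33.
  - by exists w; split=> //; apply/consecutiveU/Or31.
  - by exists w; split=> //; apply/consecutiveU/Or32.
rewrite cardfsU1; suff -> : x \notin (osc_set F s t `|` osc_set G s t)%fset by [].
rewrite in_fsetU negb_or; apply/andP; split; apply/negP => /osc_setP[w [[wF' xF' wx _] _ _]].
  by have := FG _ _ xF' xG'; rewrite ltxx.
by move: wx; rewrite ltNge xmin.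
Qed.

Lemma osc_le0 F s t : (forall x, x \in F -> (s x <= t x)%N) -> osc F s t = 0%N.
Proof.
move=> le; rewrite oscE; apply/eqP; rewrite cardfs_eq0; apply/eqP/fsetP => x.
rewrite in_fset0; apply/negP => /osc_setP[y [[_ /le xF _ _] _]].
by rewrite ltnNge xF.
Qed.

Lemma osc_gt0 F s t : (forall x, x \in F -> (t x < s x)%N) -> osc F s t = 0%N.
Proof.
move=> gt; rewrite oscE; apply/eqP; rewrite cardfs_eq0; apply/eqP/fsetP => x.
rewrite in_fset0; apply/negP => /osc_setP[y [[/gt yF _ _ _]]].
by rewrite leqNgt yF.
Qed.

Lemma exists_fmax F : F != fset0 -> exists y, is_fmax F y.
Proof.
move=> /fset0Pn[x xF].
pose m := [arg max_(y > [` xF]%fset) val y]%O.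
exists (val m); rewrite /m; case: arg_maxP => //= y _ ymax; split; first exact: valP.
by move=> z zF; exact: (ymax [` zF]%fset).
Qed.

Lemma exists_fmin F : F != fset0 -> exists y, is_fmin F y.
Proof.
move=> /fset0Pn[x xF].
pose m := [arg min_(y < [` xF]%fset) val y]%O.
exists (val m); rewrite /m; case: arg_minP => //= y _ ymin; apply/fminP; split; first exact: valP.
by move=> z zF; exact: (ymin [` zF]%fset).
Qed.

End Oscillation.

(** * Critical levels *)

Section Traces.
Context {d : Order.disp_t} {W : orderType d} (HW : is_omega1 W).
Context (e : W -> W -> nat) (e_fin : finite_to_one e) (e_coh : coherent e).
Context (L : {fset W} -> {fset W}) (HL : lower_trace L).
Context (A B : set W) (uncA : ~ countable A) (uncB : ~ countable B).
Implicit Types (a b c v x y : W) (F G : {fset W}).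

Lemma finite_sublevel b n : finite_set [set x | x < b /\ (e b x < n)%N].
Proof.
apply: (@sub_finite_set _ _ (\bigcup_(m in `I_n) [set x | x < b /\ e b x = m])).
  by move=> x [xb xn]; exists (e b x).
by apply: bigcup_finite => [|m _]; [exact: finite_II|exact: e_fin].
Qed.

(** Every a above v can be moved arbitrarily far up in A, keeping finitely many
    values below v, and at the same time making e_a' as large as desired on an
    initial stretch [v, c) of the points from v on.  It matters that v is chosen
    before n and c: the bound n will come from a block that is known only to lie
    above v. *)
Definition liftable v : Prop :=
  forall a F n c, A a -> v <= a -> all (< v) F -> exists a', [/\ A a', c <= a',
    {in F, e a' =1 e a} & forall x, v <= x -> x < c -> (n <= e a' x)%N].

(** A reflecting level v is liftable.  Since e_a is finite-to-one, e_a >= n holds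
    from some u < v up to v, so for every c' < v the element a itself has the
    required property on [u, c').  By reflection no c' whatsoever can fail. *)
Lemma exists_liftable c : exists2 v, c < v & liftable v.
Proof.
pose Q (k : nat * seq nat) (s : seq W) : set W :=
  if s is u :: F then
    [set c' | ~ exists a', [/\ A a', c' <= a', map (e a') F = k.2 &
                               forall x, u <= x -> x < c' -> (k.1 <= e a' x)%N]]
  else set0.
have [v [cv lim Qv]] := exists_reflecting HW Q c.
exists v => // a F n c' Aa va Fv; apply: contrapT => na'.
have [] := @limit_bounds_finite _ _ v [set x | x < v /\ (e a x < n)%N] lim.
- apply: sub_finite_set (finite_sublevel a n) => x [xv xn]; split=> //.
  exact: lt_le_trans va.
- by move=> x [].
move=> u uv umax.
have [||y yv] := Qv (n, map (e a) F) (u :: F).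
- by rewrite /= uv.
- exists c' => -[a' [Aa' ca' /eq_in_map Fa' na]]; apply: na'; exists a'; split=> // x vx.
  by apply: na; exact: le_trans (ltW uv) vx.
apply; exists a; split=> //; first exact: le_trans (ltW yv) va.
move=> x ux xy; rewrite leqNgt; apply/negP => xn.
by have := umax x (conj (lt_trans xy yv) xn); rewrite ltNge ux.
Qed.

(** The level v looks, for some a and b above it, like a level at which F is the
    trace L(v, b) and va, vb list the values of e_a, e_b on F.  The thresholds c0
    and c make the agreement of e_a with e_b and the growth of L(x, v) uniform,
    so that they persist at the points below v when v is replaced by another
    level with the same parameters. *)
Definition twins c0 c (F : seq W) (va vb : seq nat) v : Prop :=
  exists a b, [/\ A a, B b, v <= a & v <= b] /\
  [/\ ltr L v b =i F, map (e a) F = va, map (e b) F = vb,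
      forall x, c0 < x -> x < v -> e a x = e b x &
      forall x, c < x -> x < v -> exists2 m, is_fmin (ltr L x v) m & c0 < m].

(** What is used about a level v that reflects: [critical_above] finds a larger
    level with the same finite data, [critical_below] an element of A below v. *)
Record critical v : Prop := Critical {
  critical_limit : is_limit v;
  critical_liftable : forall c, c < v -> exists u, [/\ c < u, u < v & liftable u];
  critical_above : forall c0 c (F : seq W) va vb, c0 < v -> c < v -> all (< v) F ->
    twins c0 c F va vb v -> exists2 u, v < u & twins c0 c F va vb u;
  critical_below : forall c F a, c < v -> all (< v) F -> A a -> v <= a ->
    exists a', [/\ A a', c < a', a' < v & {in F, e a' =1 e a}] }.

Lemma exists_critical : exists v, critical v.
Proof.
(* For the clause about twins, the family consists of the upper bounds of a set of
   levels: if that set had no element above v, then v would be one of its upper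
   bounds, hence some y < v would be another, although v is in the set. *)
pose Q (k : unit + (seq nat * seq nat) + seq nat) (s : seq W) : set W :=
  match k, s with
  | inl (inl _), [:: c] => [set u | c < u /\ liftable u]
  | inl (inr (va, vb)), c0 :: c :: F => [set y | forall u, twins c0 c F va vb u -> u <= y]
  | inr va, c :: F => [set a | [/\ A a, c < a & map (e a) F = va]]
  | _, _ => set0
  end.
have [c _] := countable_bounded HW (@countable0 W).
have [v [_ lim Qv]] := exists_reflecting HW Q c.
exists v; split=> //.
- move=> u uv; have [w uw lw] := exists_liftable u.
  have [||y yv [uy ly]] := Qv (inl (inl tt)) [:: u]; first by rewrite /= uv.
    by exists w.
  by exists y.
- move=> c0 c1 F va vb c0v c1v Fv tw; apply: contrapT => nu.
  have [||y yv ymax] := Qv (inl (inr (va, vb))) (c0 :: c1 :: F).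
  + by rewrite /= c0v c1v.
  + by exists v => u tu; rewrite leNgt; apply/negP => vu; apply: nu; exists u.
  + by have := ymax v tw; rewrite leNgt yv.
- move=> c1 F a c1v Fv Aa va.
  have [||a' a'v [Aa' ca' /eq_in_map Fa']] := Qv (inr (map (e a) F)) (c1 :: F).
  + by rewrite /= c1v.
  + by exists a; split=> //; exact: lt_le_trans va.
  + by exists a'.
Qed.

Lemma trace_below v b : v <= b -> all (< v) (ltr L v b).
Proof.
move=> vb; apply/allP => x /=; rewrite /ltr; case: eqVneq => [//|nvb] xL.
apply: (lower_trace_sub HL (a := v) (b := b)); first by rewrite lt_neqAle nvb.
by rewrite /ltr (negPf nvb).
Qed.

(** L(v, b') is L(v, b) followed by a nonempty block G inside the interval (c, v);
    both pairs have the same values on L(v, b). *)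
Record extension v c a b a' b' G : Prop := Extension {
  extension_A : A a' /\ v <= a';
  extension_B : B b' /\ v <= b';
  extension_trace : ltr L v b' = (ltr L v b `|` G)%fset;
  extension_lt : fset_lt (ltr L v b) G;
  extension_neq0 : G != fset0;
  extension_between : forall x, x \in G -> c < x /\ x < v;
  extension_eq_a : {in ltr L v b, e a' =1 e a};
  extension_eq_b : {in ltr L v b, e b' =1 e b} }.

(** * Raising the oscillation by one *)

Section AtCritical.
Context (v : W) (Hv : critical v).

(** The data of v, a, b recur at a level v' > v with a', b' above v'.  There
    L(v', b') is the old L(v, b), and L(v, v') lies above the threshold c0, hence
    above L(v', b'); so L(v, b') is L(v, b) followed by G = L(v, v').  The functions
    e_a', e_b' agree on G because they agree between c0 and v'. *)
Lemma extension_eq c a b : A a -> B b -> v <= a -> v <= b -> c < v ->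
  exists a' b' G, extension v c a b a' b' G /\ {in G, e a' =1 e b'}.
Proof.
move=> Aa Bb va vb cv; have lim := critical_limit Hv.
have Lv := trace_below vb.
have [c1 c1v Lc1] := limit_bounds_seq lim Lv.
have [] := @limit_bounds_finite _ _ v [set x | x < v /\ e a x <> e b x] lim.
- apply: sub_finite_set (e_coh a b) => x [xv xab].
  by split=> //; exact: lt_le_trans xv _.
- by move=> x [].
move=> c2 c2v abc2.
(* Above c0 there is neither a point of L(v, b) nor, below v, a point where e_a and
   e_b differ. *)
pose c0 := Order.max c (Order.max c1 c2).
have cc0 : c <= c0 by rewrite le_max lexx.
have c10 : c1 <= c0 by rewrite !le_max lexx orbT.
have c20 : c2 <= c0 by rewrite !le_max lexx !orbT.
have c0v : c0 < v by rewrite !gt_max cv c1v.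
have [c3 c3v minL] := lower_trace_lim HL lim c0v.
have tw : twins c0 c3 (ltr L v b) (map (e a) (ltr L v b)) (map (e b) (ltr L v b)) v.
  exists a, b; split=> //; split=> // x c0x xv; apply: contrapT => xab.
  by have := abc2 x (conj xv xab); rewrite ltNge (le_trans c20 (ltW c0x)).
have [v' vv' [a' [b' [[Aa' Bb' va' vb'] [LF Fa Fb eab minL']]]]] :=
  critical_above Hv c0v c3v Lv tw.
have {}LF : ltr L v' b' = ltr L v b by apply/fsetP => x; rewrite LF.
have [m /fminP[mL mmin] c0m] := minL' v c3v vv'.
have c0L x : x \in ltr L v v' -> c0 < x by move=> /mmin; exact: lt_le_trans.
have ltL : fset_lt (ltr L v b) (ltr L v v').
  move=> x y /(allP Lc1) /= xc1 /c0L c0y.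
  exact: lt_trans (lt_le_trans xc1 c10) c0y.
have Lv' : {in ltr L v v', forall x, x < v} by move=> x; exact: (lower_trace_sub HL vv').
exists a', b', (ltr L v v'); split; last first.
  by move=> x xL; apply: eab (c0L _ xL) (lt_trans (Lv' _ xL) vv').
split.
- by split=> //; exact: le_trans (ltW vv') va'.
- by split=> //; exact: le_trans (ltW vv') vb'.
- by rewrite (lower_trace_cat HL (ltW vv') vb') LF // fsetUC.
- exact: ltL.
- by apply/fset0Pn; exists m.
- by move=> x xL; split; [exact: le_lt_trans cc0 (c0L x xL)|exact: Lv'].
- exact/eq_in_map.
- exact/eq_in_map.
Qed.

(** Take the block G of an extension above a liftable level u < v, then lift a to
    an a' whose values on [u, v), which includes G, exceed those of e_b' on G. *)
Lemma extension_gt c a b : A a -> B b -> v <= a -> v <= b -> c < v ->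
  exists a' b' G, extension v c a b a' b' G /\ {in G, forall x, (e b' x < e a' x)%N}.
Proof.
move=> Aa Bb va vb cv.
have [c1 c1v Lc1] := limit_bounds_seq (critical_limit Hv) (trace_below vb).
have [|u [cu uv liftu]] := @critical_liftable _ Hv (Order.max c c1); first by rewrite gt_max cv.
move: cu; rewrite gt_max => /andP[cu c1u].
have Lu : all (< u) (ltr L v b).
  by apply: sub_all Lc1 => x /= xc1; exact: lt_trans c1u.
have [a1 [b' [G [ext _]]]] := extension_eq Aa Bb va vb uv.
have [a' [Aa' va' ea' nG]] :=
  liftu a (ltr L v b) (\max_(x <- G) e b' x).+1 v Aa (le_trans (ltW uv) va) Lu.
exists a', b', G; split.
  case: ext => _ HB HLt Hlt Hn0 Hbtw _ Hb; split=> // x /Hbtw[ux xv].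
  by split=> //; exact: lt_trans cu ux.
move=> x xG; have [ux xv] := extension_between ext xG.
by apply: leq_trans (nG x (ltW ux) xv); rewrite ltnS; exact: leq_bigmax_seq.
Qed.

(** An equality block followed by a strict block: the only new oscillation is at
    the first point of the strict block.  The last clause makes the next joint
    harmless, whatever is put after L(v, b'). *)
Lemma osc_succ a b : A a -> B b -> v <= a -> v <= b -> exists a' b',
  [/\ A a' /\ v <= a', B b' /\ v <= b',
      {subset ltr L v b <= ltr L v b'} /\ {in ltr L v b, e a' =1 e a},
      osc (ltr L v b') (e a') (e b') = (osc (ltr L v b) (e a) (e b)).+1 &
      forall y, is_fmax (ltr L v b') y -> (e b' y < e a' y)%N].
Proof.
move=> Aa Bb va vb; have [[c cv] _] := critical_limit Hv.
have [a1 [b1 [G [ext1 eqG]]]] := extension_eq Aa Bb va vb cv.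
have [[Aa1 va1] [Bb1 vb1] L1 lt1 n01 _ ea1 eb1] := ext1.
have [a2 [b2 [H [ext2 gtH]]]] := extension_gt Aa1 Bb1 va1 vb1 cv.
have [A2 B2 L2 lt2 n02 _ ea2 eb2] := ext2.
have [y [yG ymax]] := exists_fmax n01; have [z zH] := exists_fmin n02.
have [zH' _] := fminP _ _ zH.
have yL1 : is_fmax (ltr L v b1) y.
  rewrite L1; split=> [|x]; first by rewrite inE yG orbT.
  by rewrite inE => /orP[xL|]; [exact/ltW/lt1|exact: ymax].
exists a2, b2; split=> //.
- split=> x xL; first by rewrite L2 L1 !inE xL.
  by rewrite ea2 ?ea1 // L1 inE xL.
- rewrite L2 (osc_cat_joint lt2 yL1 zH); last exact: gtH.
    rewrite (osc_gt0 gtH) addn0 (eq_osc ea2 eb2) L1 osc_cat //.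
      by rewrite (eq_osc ea1 eb1) (@osc_le0 _ _ G) ?addn0 // => x /eqG->.
    by move=> w x _ /fminP[/eqG-> _].
  by have [yL _] := yL1; rewrite ea2 // eb2 // eqG.
- move=> x []; rewrite L2 inE => /orP[xL1|/gtH//] xmax.
  have := xmax z; rewrite inE zH' orbT => /(_ erefl).
  by rewrite leNgt lt2.
Qed.

(** One a serves all b_i: each step preserves the values of e_a on the current
    trace, which contains all the previous ones. *)
Lemma osc_interval n : exists k a (b : nat -> W), [/\ A a, v <= a &
  forall i, (i <= n)%N -> [/\ B (b i) /\ v <= b i,
    {subset ltr L v (b i) <= ltr L v (b n)},
    osc (ltr L v (b i)) (e a) (e (b i)) = (k + i)%N &
    forall y, is_fmax (ltr L v (b i)) y -> (e (b i) y < e a y)%N]].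
Proof.
elim: n => [|n [k [a [b [Aa va IH]]]]].
  have [a0 Aa0 va0] := uncountable_unbounded HW uncA v.
  have [b0 Bb0 vb0] := uncountable_unbounded HW uncB v.
  have [a [b [[Aa va] HB _ _ gt]]] := osc_succ Aa0 Bb0 va0 vb0.
  exists (osc (ltr L v b) (e a) (e b)), a, (fun=> b); split=> // i.
  by rewrite leqn0 => /eqP->; split; rewrite ?addn0.
have [[Bbn vbn] _ oscn _] := IH n (leqnn n).
have [a' [b' [[Aa' va'] HB' [sub' ea'] osc' gt']]] := osc_succ Aa Bbn va vbn.
exists k, a', (fun i => if (i <= n)%N then b i else b'); split=> // i.
rewrite ltnn; case: (leqP i n) => [|ni] iS; last first.
  have -> : i = n.+1 by apply/anti_leq; rewrite iS ni.
  by split=> //; rewrite osc' oscn addnS.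
have [HBi sub osci gti] := IH i iS.
have ea : {in ltr L v (b i), e a' =1 e a} by move=> x /sub; exact: ea'.
split=> //.
- by move=> x /sub /sub'.
- by rewrite (eq_osc ea (fun _ _ => erefl)).
- by move=> y ymax; have [yL _] := ymax; rewrite ea //; exact: gti.
Qed.

End AtCritical.

Lemma coherent_tails v n (b : nat -> W) : is_limit v ->
  (forall i, (i <= n)%N -> v <= b i) -> exists2 c, c < v &
  forall i x, (i <= n)%N -> c < x -> x < v -> e (b i) x = e (b 0%N) x.
Proof.
move=> lim vb.
have [] := @limit_bounds_finite _ _ v
  (\bigcup_(i in `I_n.+1) [set x | x < v /\ e (b i) x <> e (b 0%N) x]) lim.
- apply: bigcup_finite => [|i /= iS]; first exact: finite_II.
  apply: sub_finite_set (e_coh (b i) (b 0%N)) => x [xv xab].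
  by split=> //; apply: lt_le_trans xv (vb _ _).
- by move=> x [i _ []].
move=> c cv cmax; exists c => // i x iS cx xv; apply: contrapT => neq.
have : x < c by apply: cmax; exists i.
by rewrite ltNge (ltW cx).
Qed.

End Traces.

(** * The oscillations over L(a, b) *)

Theorem theorem1p14 (d : Order.disp_t) (W : orderType d) (HW : is_omega1 W)
  (e : W -> W -> nat) (e_fin : finite_to_one e) (e_coh : coherent e)
  (L : {fset W} -> {fset W}) (HL : lower_trace L)
  (A B : set W) (uncA : ~ countable A) (uncB : ~ countable B) :
  forall n : nat, exists k : nat, forall i : nat, (i < n)%N ->
    exists a b : W, [/\ A a, B b, (a < b)%O &
      osc (ltr L a b) (e a) (e b) = (k + i)%N].
Proof.
move=> n.
have [v Hv] := exists_critical HW e_fin L A B.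
have [k [a [b [Aa va chain]]]] := osc_interval HW e_coh HL uncA uncB Hv n.
have lim := critical_limit Hv.
have [[_ vbn] _ _ _] := chain n (leqnn n).
have Lv := trace_below HL vbn.
have [|c1 c1v tails] := coherent_tails e_coh (n := n) (b := b) lim.
  by move=> i /chain[[]].
have [c2 c2v Lc2] := limit_bounds_seq lim Lv.
pose c0 := Order.max c1 c2.
have c0v : c0 < v by rewrite gt_max c1v.
have [c cv minL] := lower_trace_lim HL lim c0v.
have [a' [Aa' ca' a'v ea']] := critical_below Hv cv Lv Aa va.
have [m /fminP[_ mmin] c0m] := minL a' ca' a'v.
have c0L x : x \in ltr L a' v -> c0 < x by move=> /mmin; exact: lt_le_trans.
exists (k + osc (ltr L a' v) (e a') (e (b 0%N)))%N => i /ltnW iS.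
have [[Bi vbi] sub osci gti] := chain i iS.
have ltL : fset_lt (ltr L v (b i)) (ltr L a' v).
  move=> x y /sub/(allP Lc2) /= xc2 /c0L; rewrite gt_max => /andP[_].
  exact: lt_trans.
have ea : {in ltr L v (b i), e a' =1 e a} by move=> x /sub; exact: ea'.
exists a', (b i); split=> //; first exact: lt_le_trans a'v vbi.
(* L(a', b_i) is L(v, b_i) followed by L(a', v), with a harmless joint. *)
rewrite (lower_trace_cat HL (ltW a'v) vbi ltL) fsetUC osc_cat //.
  rewrite (eq_osc ea (fun _ _ => erefl)) osci addnAC; congr (_ + _ + _)%N.
  apply: eq_osc => // x xL; apply: tails => //.
    by have := c0L x xL; rewrite gt_max => /andP[].
  exact: lt_trans (lower_trace_sub HL a'v xL) a'v.
move=> y x ymax _; have [yL _] := ymax.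
by rewrite ea // leqNgt gti.
Qed.
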